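(* Let $n \ge 3$ be an integer and let $\Im$ be a strongly balanced tiling of the plane all of whose tiles are convex $n$-gons. Then $$\sum_{h \ge 3} h \cdot t_h(\Im) \le 6.$$
   Context: A tiling is a collection of closed sets (tiles) covering the plane with pairwise disjoint interiors. A convex $n$-gon is a convex polygon with exactly $n$ sides and $n$ corners (all interior angles less than $180^\circ$); the tiles of a tiling by convex $n$-gons need not be congruent and the tiling need not be edge-to-edge. A vertex of the tiling is a point belonging to at least three tiles, and its valence is the number of tiles meeting there (so valences are at least three). The vertices divide the boundaries of the tiles into arcs, called the edges of the tiling. (Corners and sides belong to the polygons; vertices and edges belong to the tiling.) Two distinct tiles are adjacent if they have an edge of the tiling in common; the adjacents of a tile are the tiles adjacent to it. A tiling is normal if (i) every tile is a topological disk; (ii) the intersection of every two tiles is a connected set; (iii) the tiles are uniformly bounded: there are $u,U>0$ such that every tile contains some disk of radius $u$ and is contained in some disk of radius $U$. For $r>0$ and an arbitrary point $M$ of the plane, let $D(r,M)$ be the closed disk of radius $r$ centered at $M$. Let $F_1$ be the set of tiles contained in $D(r,M)$, $F_2$ the set of tiles meeting the boundary of $D(r,M)$ but not contained in $D(r,M)$, and $F_3$ the set of tiles surrounded by the tiles of $F_2$ but not belonging to $F_2$. The patch $A(r,M)$ is $F_1\cup F_2\cup F_3$. Let $t(r,M)$ be the number of tiles in $A(r,M)$, $t_h(r,M)$ the number of tiles in $A(r,M)$ with exactly $h$ adjacents, and $v_j(r,M)$ the number of $j$-valent vertices in $A(r,M)$. A tiling $\Im$ is strongly balanced if it is normal and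 all the limits $t_h(\Im)=\lim_{r\to\infty} t_h(r,M)/t(r,M)$ and $v_j(\Im)=\lim_{r\to\infty} v_j(r,M)/t(r,M)$ exist. *)

(* Defs.v *)
From mathcomp Require Import all_boot all_order all_algebra finmap.
From mathcomp Require Import all_classical all_reals all_analysis.

Set Implicit Arguments.
Unset Strict Implicit.
Unset Printing Implicit Defensive.

Import Order.TTheory GRing.Theory Num.Theory.
Import numFieldNormedType.Exports.

Local Open Scope classical_set_scope.
Local Open Scope ring_scope.

Notation plane R := 'rV[R]_2.

(* [fset_set] is empty on infinite sets; it is only used below for patches of
   normal tilings, which have finitely many tiles and vertices. *)
Definition ncard {X : choiceType} (A : set X) : nat := #|` fset_set A|%fset.

Section PlaneGeometry.
Context {R : realType}.
Implicit Types (A : set (plane R)) (M x : plane R) (r : R).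

(* The library norm on 'rV_2 is the sup norm: it induces the right topology
   and the right bounded sets, but disks need the Euclidean distance. *)
Definition edist (x y : plane R) : R :=
  Num.sqrt (\sum_(i < 2) (x ord0 i - y ord0 i) ^+ 2).

Definition disk r M : set (plane R) := [set x | edist x M <= r].

Definition boundary A : set (plane R) := closure A `\` A°.

Definition topological_disk A : Prop :=
  exists f g : plane R -> plane R,
    [/\ {within disk 1 0, continuous f}, {within A, continuous g},
        f @` disk 1 0 = A & {in disk 1 0, cancel f g}].

Definition conv_hull A : set (plane R) := smallest (@convex_set R (plane R)) A.

(* The [p i] are the corners: no corner is in the hull of the others, so all
   of them are extreme points (interior angles less than a straight angle),
   and they are pairwise distinct.  Meaningful for n >= 3. *)
Definition convex_ngon (n : nat) A : Prop :=
  exists p : 'I_n -> plane R,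
    (forall i, ~ conv_hull (p @` [set j | j != i]) (p i)) /\
    A = conv_hull (range p).

End PlaneGeometry.

Section Tilings.
Context {R : realType}.
Implicit Types (T : set (set (plane R))) (A B K E : set (plane R)).
Implicit Types (M x : plane R) (r : R) (h j n : nat).

Definition tiling T : Prop :=
  [/\ forall A, T A -> closed A,
      \bigcup_(A in T) A = setT &
      forall A B, T A -> T B -> A <> B -> A° `&` B° = set0].

Definition tiles_at T x : set (set (plane R)) := [set A | T A /\ A x].

Definition is_vertex T x : Prop := (`I_3 #<= tiles_at T x)%card.

Definition has_valence T j x : Prop := (tiles_at T x #= `I_j)%card.

(* The vertices are removed from the boundary of A; an edge is one of the
   remaining pieces together with its end points. *)
Definition edge_of T A E : Prop :=
  exists2 x, (boundary A `\` is_vertex T) x &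
    E = closure (connected_component (boundary A `\` is_vertex T) x).

Definition adjacent T A B : Prop :=
  [/\ T A, T B, A <> B & exists E, edge_of T A E /\ edge_of T B E].

Definition has_adjacents T h A : Prop :=
  ([set B | adjacent T A B] #= `I_h)%card.

Definition normal_tiling T : Prop :=
  [/\ tiling T,
      forall A, T A -> topological_disk A,
      forall A B, T A -> T B -> connected (A `&` B) &
      exists u U : R, [/\ 0 < u, 0 < U &
        forall A, T A -> (exists c, disk u c `<=` A) /\
                         (exists c, A `<=` disk U c)]].

(* K surrounds B: B has no point in an unbounded component of the complement
   of K. *)
Definition surrounded_by K B : Prop :=
  forall x, B x -> ~ K x -> bounded_set (connected_component (~` K) x).

Definition patch_F1 T r M : set (set (plane R)) :=
  [set A | T A /\ A `<=` disk r M].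

Definition patch_F2 T r M : set (set (plane R)) :=
  [set A | [/\ T A, A `&` boundary (disk r M) !=set0 & ~ A `<=` disk r M]].

Definition patch_F3 T r M : set (set (plane R)) :=
  [set A | [/\ T A, ~ patch_F2 T r M A &
               surrounded_by (\bigcup_(B in patch_F2 T r M) B) A]].

Definition patch T r M : set (set (plane R)) :=
  patch_F1 T r M `|` patch_F2 T r M `|` patch_F3 T r M.

Definition num_tiles T r M : nat := ncard (patch T r M).

Definition num_tiles_adj T h r M : nat :=
  ncard [set A | patch T r M A /\ has_adjacents T h A].

(* A vertex is in the patch when it lies in one of its tiles; its valence is
   counted in the whole tiling. *)
Definition num_vertices T j r M : nat :=
  ncard [set x | [/\ (\bigcup_(A in patch T r M) A) x,
                     is_vertex T x & has_valence T j x]].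

Definition tile_ratio T M h (r : R) : R :=
  (num_tiles_adj T h r M)%:R / (num_tiles T r M)%:R.

Definition vertex_ratio T M j (r : R) : R :=
  (num_vertices T j r M)%:R / (num_tiles T r M)%:R.

(* The limits are taken along the disks centered at one point M, the arbitrary
   base point of the patches. *)
Definition strongly_balanced T M : Prop :=
  [/\ normal_tiling T,
      forall h, cvg (tile_ratio T M h @ +oo) &
      forall j, cvg (vertex_ratio T M j @ +oo)].

Definition tile_density T M h : R := lim (tile_ratio T M h @ +oo).

End Tilings.

(* Main.v *)
Require Import Defs.
From mathcomp Require Import all_boot all_order all_algebra finmap.
From mathcomp Require Import all_classical all_reals all_analysis.
From mathcomp Require Import ring lra zify.
(* again: the disks use the Euclidean [edist], not the extended distance *)
Import Defs.
Import Order.TTheory GRing.Theory Num.Theory.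
Import numFieldNormedType.Exports.

(** The average number of adjacents of a tile is at most 6 for the same reason
    as in a finite planar graph, but with convex tiles there is no need for
    Euler's formula.

    Each tile has at most as many adjacents as there are vertices of the tiling
    on it ([adjacents_vertices]): it meets an adjacent in a segment, the
    counterclockwise end of this segment is a vertex, and two adjacents cannot
    give the same end.

    Incidences between vertices and tiles are then counted with a linear height
    function that separates the finitely many vertices at hand
    ([valence_sum]).  At a vertex [x], at most one tile continues the level line
    to the left of [x] and at most one to the right; every other tile has [x] as
    its lowest or its highest point.  If [k] tiles are of the latter kind, the
    valence of [x] is at most [k + 2] and at least 3, hence at most [3 k].  Each
    tile has one lowest and one highest point, so there are at most 6 incidences
    per tile.

    For a patch of radius [r] this bounds the total number of adjacents by 6
    times the number of tiles that meet the disk of radius [r + 2 U], where [U]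
    bounds the diameters ([adjacents_sum]), while the patch contains all the
    tiles that meet the disk of radius [r].  The number of tiles meeting a disk
    is at most quadratic in the radius, because the tiles are fat
    ([tiles_meeting_card]).  So it cannot be multiplied by a fixed factor larger
    than 1 at each step of length [2 U], and the two numbers have a ratio
    arbitrarily close to 1 for arbitrarily large radii ([slow_growth]).  Since
    the limits are assumed to exist, such radii are enough
    ([partial_density_le6]). *)

(** * Convex sets of the plane *)

Section ConvexPlane.
Local Open Scope classical_set_scope.
Local Open Scope ring_scope.
Context {R : realType}.
Implicit Types (A B : set (plane R)) (x y z a b c p q : plane R) (s t : R).

Lemma ord2P (j : 'I_2) : j = 0 \/ j = 1.
Proof. by case: j => [[|[|?]] ?]; [left|right|]; try exact/val_inj. Qed.

Lemma plane_eq x y : x 0 0 = y 0 0 -> x 0 1 = y 0 1 -> x = y.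
Proof.
move=> e0 e1; apply/matrixP => i j; rewrite !ord1.
by have [->|->] := ord2P j.
Qed.

Definition convex A :=
  forall x y t, A x -> A y -> 0 <= t <= 1 -> A (x + t *: (y - x)).

(** Twice the signed area of the triangle 0, [x], [y]; it is positive when [y]
    is counterclockwise from [x]. *)
Definition cross x y : R := x 0 0 * y 0 1 - x 0 1 * y 0 0.

Lemma interior_normP A x :
  A° x <-> exists2 e : R, 0 < e & forall y, `|y - x| < e -> A y.
Proof.
split=> [/nbhs_ballP[e /= e0 eA]|[e e0 eA]].
  by exists e => // y yx; apply: eA; rewrite -ball_normE /= distrC.
apply/nbhs_ballP; exists e => //= y; rewrite -ball_normE /= distrC; exact: eA.
Qed.

Lemma convex_interior A a x t :
  convex A -> A° a -> A x -> 0 < t <= 1 -> A° (x + t *: (a - x)).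
Proof.
move=> cA /interior_normP[e e0 eA] Ax /andP[t0 t1].
apply/interior_normP; exists (t * e); first by rewrite mulr_gt0.
move=> y yx; have tn0 : t != 0 by rewrite gt_eqF.
pose b := x + t^-1 *: (y - x).
have -> : y = x + t *: (b - x).
  by rewrite /b addrAC subrr add0r scalerA divff// scale1r addrCA subrr addr0.
apply: cA => //; last by rewrite (ltW t0).
apply: eA; have -> : b - a = t^-1 *: (y - (x + t *: (a - x))).
  by apply: plane_eq; rewrite !mxE; field.
by rewrite normrZ gtr0_norm ?invr_gt0// mulrC ltr_pdivrMr// mulrC.
Qed.

Lemma convex_triangle A x y z s t : convex A -> A x -> A y -> A z ->
  0 <= s -> 0 <= t -> s + t <= 1 -> A (x + s *: (y - x) + t *: (z - x)).
Proof.
move=> cA Ax Ay Az s0 t0 st.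
have [s1|s1] := eqVneq s 1.
  have -> : t = 0 by lra.
  by rewrite s1 scale0r addr0; apply: cA => //; rewrite lexx ler01.
have s1' : 0 < 1 - s by rewrite subr_gt0 lt_neqAle s1; lra.
have Aw : A (x + (t / (1 - s)) *: (z - x)).
  by apply: cA => //; rewrite divr_ge0 ?(ltW s1')//= ler_pdivrMr//; lra.
rewrite (_ : _ + _ = x + (t / (1 - s)) *: (z - x) + s *: (y - (x + (t / (1 - s)) *: (z - x)))).
  by apply: cA => //; lra.
by apply: plane_eq; rewrite !mxE; field; rewrite gt_eqF.
Qed.

Lemma convex_triangle_interior A a x y s t : convex A -> A° a -> A x -> A y ->
  0 < s -> 0 <= t -> s + t <= 1 -> A° (x + s *: (a - x) + t *: (y - x)).
Proof.
move=> cA Aa Ax Ay s0 t0 st.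
have [s1|s1] := eqVneq s 1.
  have -> : t = 0 by lra.
  by rewrite s1 scale0r addr0; apply: convex_interior => //; rewrite lexx ltr01.
have s1' : 0 < 1 - s by rewrite subr_gt0 lt_neqAle s1; lra.
have Aw : A (x + (t / (1 - s)) *: (y - x)).
  by apply: cA => //; rewrite divr_ge0 ?(ltW s1')//= ler_pdivrMr//; lra.
rewrite (_ : _ + _ = x + (t / (1 - s)) *: (y - x) + s *: (a - (x + (t / (1 - s)) *: (y - x)))).
  by apply: convex_interior => //; lra.
by apply: plane_eq; rewrite !mxE; field; rewrite gt_eqF.
Qed.

(** Any point of [B] is a limit of interior points of [B], so an open set that
    met [B] would meet its interior. *)
Lemma interior_disjoint A B b : convex A -> convex B -> B° b ->
  A° `&` B° = set0 -> A° `&` B = set0.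
Proof.
move=> cA cB Bb AB; rewrite -subset0 => y [Ay By].
have [e e0 eA] : exists2 e : R, 0 < e & forall z, `|z - y| < e -> A° z.
  by apply/interior_normP/open_nbhs_nbhs; split => //; exact: open_interior.
pose t := e / (e + `|b - y| + 1).
have d0 : 0 < e + `|b - y| + 1 by have := normr_ge0 (b - y); lra.
have t0 : 0 < t by rewrite divr_gt0.
have t1 : t <= 1 by rewrite ler_pdivrMr// mul1r; have := normr_ge0 (b - y); lra.
suff : set0 (y + t *: (b - y)) by [].
rewrite -AB; split.
  apply: eA; rewrite addrAC subrr add0r normrZ gtr0_norm// /t mulrAC ltr_pdivrMr//.
  by rewrite ltr_pM2l//; lra.
by apply: convex_interior => //; rewrite t0.
Qed.

Lemma cross_collinear x y : x != 0 -> cross x y = 0 -> exists s, y = s *: x.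
Proof.
move=> x0 xy.
pose n2 := x 0 0 ^+ 2 + x 0 1 ^+ 2.
have n0 : n2 != 0.
  apply: contra x0; rewrite paddr_eq0 ?sqr_ge0// !sqrf_eq0 => /andP[/eqP a /eqP b].
  by apply/eqP/plane_eq; rewrite ?a ?b mxE.
exists ((x 0 0 * y 0 0 + x 0 1 * y 0 1) / n2).
rewrite /cross in xy.
apply: plane_eq; rewrite !mxE; apply: (mulIf n0);
  rewrite [RHS]mulrAC divfK// /n2.
  by rewrite -[LHS]addr0 -(mulr0 (x 0 1)) -xy; ring.
by rewrite -[LHS]addr0 -(mulr0 (- x 0 0)) -xy; ring.
Qed.

Lemma cross_basis x y z : cross x y != 0 -> exists s t, z = s *: x + t *: y.
Proof.
move=> xy; exists (cross z y / cross x y), (cross x z / cross x y).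
by apply: plane_eq; rewrite !mxE; move: xy; rewrite /cross => xy; field.
Qed.

(** If [c], [p] and [q] were aligned, either [c] would lie between [p] and [q],
    hence in [B], or one of [p] and [q] would lie between [c] and the other,
    hence in the interior of [A]. *)
Lemma cross_chord A B c p q : convex A -> convex B -> A° `&` B = set0 ->
  A° c -> A p -> A q -> B p -> B q -> p != q -> cross (p - c) (q - c) != 0.
Proof.
move=> cA cB AB Ac Ap Aq Bp Bq pq; apply/eqP => pcq0.
have nAB z : A° z -> B z -> False.
  by move=> Az Bz; have : set0 z by rewrite -AB.
have ndir u v t : A v -> B v -> B u -> 0 < t <= 1 -> u <> v + t *: (c - v).
  move=> Av Bv Bu t01 uE; apply: (nAB u) => //; rewrite uE.
  exact: convex_interior.
have pc : p - c != 0.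
  by rewrite subr_eq0; apply/eqP => pc; apply: (nAB c) => //; rewrite -pc.
have [s sE] := cross_collinear _ _ pc pcq0.
have qE : q = c + s *: (p - c) by rewrite -sE addrC subrK.
have [s0|s0] := lerP s 0.
  apply: (nAB c) => //.
  have -> : c = p + (1 - s)^-1 *: (q - p).
    by rewrite qE; apply: plane_eq; rewrite !mxE; field; rewrite gt_eqF//; lra.
  by apply: cB => //; rewrite invr_ge0 invf_le1; lra.
have [s1|s1] := ltrP s 1.
  apply: (@ndir q p (1 - s)) => //; first by lra.
  by rewrite qE; apply: plane_eq; rewrite !mxE; ring.
have {}s1 : 1 < s.
  rewrite lt_neqAle s1 andbT eq_sym; apply/eqP => se.
  by move/eqP: pq; apply; rewrite qE se scale1r addrC subrK.
apply: (@ndir p q (1 - s^-1)) => //.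
  by rewrite subr_gt0 invf_lt1// s1/= gerBl invr_ge0 ltW.
by rewrite qE; apply: plane_eq; rewrite !mxE; field; rewrite gt_eqF.
Qed.

(** A nondegenerate triangle common to [A] and [B] has its centroid in its
    interior; moving the centroid slightly towards an interior point of [A]
    stays in the triangle, hence in [B], but enters the interior of [A]. *)
Lemma common_collinear A B c x y z : convex A -> convex B -> A° `&` B = set0 ->
  A° c -> A x -> A y -> A z -> B x -> B y -> B z -> cross (y - x) (z - x) = 0.
Proof.
move=> cA cB AB Ac Ax Ay Az Bx By Bz; apply/eqP/negP => /negP xyz.
have [a [b cE]] := cross_basis _ _ (c - x) xyz.
(* t is small enough for g + t (c - g) to keep nonnegative barycentric
   coordinates in the triangle x, y, z *)
pose t := (1 + 3 * (`|a| + `|b|))^-1.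
have m0 : 0 <= `|a| + `|b| by rewrite addr_ge0.
have t0 : 0 < t by rewrite invr_gt0; lra.
have tE : t + 3 * t * (`|a| + `|b|) = 1 by rewrite /t; field; rewrite gt_eqF//; lra.
have ta : t * `|a| + t * `|b| = (1 - t) / 3 by rewrite -mulrDr; lra.
have tn (u : R) : - (t * `|u|) <= t * u <= t * `|u|.
  by rewrite -mulrN !ler_pM2l// lerNl -{1}normrN !ler_norm.
have [/andP[a1 a2] /andP[b1 b2]] := (tn a, tn b).
have a0 : 0 <= t * `|a| by rewrite mulr_ge0 ?(ltW t0).
have b0 : 0 <= t * `|b| by rewrite mulr_ge0 ?(ltW t0).
pose g := x + 3^-1 *: (y - x) + 3^-1 *: (z - x).
have Ag : A g by apply: convex_triangle => //; lra.
suff : set0 (g + t *: (c - g)) by [].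
rewrite -AB; split; first by apply: convex_interior => //; lra.
have -> : g + t *: (c - g) = x + ((1 - t) / 3 + t * a) *: (y - x)
                               + ((1 - t) / 3 + t * b) *: (z - x).
  rewrite (_ : c - g = (c - x) - (g - x)); last by rewrite opprB addrA subrK.
  by rewrite cE; apply: plane_eq; rewrite !mxE; field.
by apply: convex_triangle => //; lra.
Qed.

(** Each of three convex sets sharing a segment has interior points strictly on
    one side of its line.  Two of them lie on the same side, and then overlap
    just above the middle of the segment. *)
Lemma three_share_no_segment A B C a b c p q :
  convex A -> convex B -> convex C -> A° a -> B° b -> C° c ->
  A° `&` B = set0 -> B° `&` C = set0 -> A° `&` C = set0 ->
  A p -> B p -> C p -> A q -> B q -> C q -> p = q.
Proof.
move=> cA cB cC Aa Bb Cc AB BC AC Ap Bp Cp Aq Bq Cq.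
apply/eqP/negP => /negP pq.
have same (D E : set (plane R)) (d e : plane R) : convex D -> convex E -> D° d -> E° e -> D° `&` E = set0 ->
    D p -> D q -> E p -> E q ->
    cross (q - p) (d - p) * cross (q - p) (e - p) <= 0.
  move=> cD cE Dd Ee DE Dp Dq Ep Eq; rewrite leNgt; apply/negP => de.
  have qd0 : cross (q - p) (d - p) != 0.
    by apply: contraTneq de => ->; rewrite mul0r ltxx.
  have [s [t eE]] := cross_basis _ _ (e - p) qd0.
  have t0 : 0 < t.
    have : 0 < t * cross (q - p) (d - p) ^+ 2.
      by move: de; congr (_ < _); rewrite eE /cross !mxE; ring.
    by rewrite pmulr_lgt0// lt0r sqr_ge0 sqrf_eq0 qd0.
  pose k := (2 * (1 + `|s| + t))^-1.
  have s0 := normr_ge0 s.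
  have k0 : 0 < k by rewrite invr_gt0; lra.
  have kE : k + k * `|s| + k * t = 2^-1 by rewrite /k; field; rewrite gt_eqF//; lra.
  have kt : 0 < k * t by rewrite mulr_gt0.
  have ks : - (k * `|s|) <= k * s <= k * `|s|.
    by rewrite -mulrN !ler_pM2l// lerNl -{1}normrN !ler_norm.
  case/andP: ks => ks1 ks2.
  have ks0 : 0 <= k * `|s| by rewrite mulr_ge0 ?(ltW k0).
  suff : set0 (p + k *: (e - p) + 2^-1 *: (q - p)) by [].
  rewrite -DE; split.
    have -> : p + k *: (e - p) + 2^-1 *: (q - p) =
       p + (k * t) *: (d - p) + (2^-1 + k * s) *: (q - p).
      by rewrite eE; apply: plane_eq; rewrite !mxE; ring.
    by apply: convex_triangle_interior => //; lra.
  by apply: convex_triangle => //; first exact: interior_subset; lra.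
have nz (D E : set (plane R)) (d : plane R) : convex D -> convex E -> D° d -> D° `&` E = set0 ->
    D p -> D q -> E p -> E q -> cross (q - p) (d - p) != 0.
  move=> cD cE Dd DE Dp Dq Ep Eq.
  have := @cross_chord D E d p q cD cE DE Dd Dp Dq Ep Eq pq.
  by apply: contra_neq => h; rewrite -[RHS]h /cross !mxE; ring.
have ab := same A B a b cA cB Aa Bb AB Ap Aq Bp Bq.
have bc := same B C b c cB cC Bb Cc BC Bp Bq Cp Cq.
have ac := same A C a c cA cC Aa Cc AC Ap Aq Cp Cq.
have na := nz A B a cA cB Aa AB Ap Aq Bp Bq.
have nb := nz B C b cB cC Bb BC Bp Bq Cp Cq.
have CA : C° `&` A = set0.
  by apply: interior_disjoint cC cA Aa _; rewrite -subset0 -AC setIC; apply: setIS; exact: interior_subset.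
have nc := nz C A c cC cA Cc CA Cp Cq Ap Aq.
move: ab bc ac na nb nc; move: (cross _ (a - p)) (cross _ (b - p)) (cross _ (c - p)).
move=> u v w uv vw uw; clear -uv vw uw; rewrite !neq_lt.
by do 3![case/orP => ?]; nra.
Qed.

(** Seen from [a], the common chord of [A] and [B] runs counterclockwise from [p]
    to its head [q].  Two chords of [A] with the same head [q] leave [q] on the
    same side of the ray from [a] to [q]: if they make an angle, the inner one
    enters the interior of [A]; if they overlap, three sets share a segment. *)
Lemma chord_head_inj A B C a b c p p' q :
  convex A -> convex B -> convex C -> A° a -> B° b -> C° c ->
  A° `&` B = set0 -> B° `&` C = set0 -> A° `&` C = set0 ->
  A p -> B p -> A p' -> C p' -> A q -> B q -> C q ->
  0 < cross (p - a) (q - a) -> 0 < cross (p' - a) (q - a) -> False.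
Proof.
move=> cA cB cC Aa Bb Cc AB BC AC Ap Bp Ap' Cp' Aq Bq Cq h h'.
(* q u is the outer chord: v lies strictly inside the angle it makes with q a *)
have wedge (E : set (plane R)) u v s t : convex E -> A° `&` E = set0 -> E q -> E v -> A u ->
    v - q = s *: (a - q) + t *: (u - q) -> 0 < s -> 0 < t -> False.
  move=> cE AE Eq Ev Au vE s0 t0.
  pose k := (1 + s + t)^-1.
  have k0 : 0 < k by rewrite invr_gt0; lra.
  have kE : k + k * s + k * t = 1 by rewrite /k; field; rewrite gt_eqF//; lra.
  have ks : 0 < k * s by rewrite mulr_gt0.
  have kt : 0 < k * t by rewrite mulr_gt0.
  suff : set0 (q + k *: (v - q)) by [].
  rewrite -AE; split; last by apply: cE => //; lra.
  have -> : q + k *: (v - q) = q + (k * s) *: (a - q) + (k * t) *: (u - q).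
    by rewrite vE; apply: plane_eq; rewrite !mxE; ring.
  by apply: convex_triangle_interior => //; lra.
have n0 : cross (a - q) (p - q) != 0.
  by rewrite (_ : cross _ _ = cross (p - a) (q - a)) ?gt_eqF// /cross !mxE; ring.
have [s [t vE]] := cross_basis _ _ (p' - q) n0.
have hE : cross (p' - a) (q - a) = t * cross (p - a) (q - a).
  have -> : p' - a = (p' - q) + (q - a) by rewrite addrA subrK.
  by rewrite vE /cross !mxE; ring.
have t0 : 0 < t by move: h'; rewrite hE pmulr_lgt0.
have [s0|s0|s0] := ltrgtP s 0.
- apply: (@wedge B p' p (- s / t) t^-1) => //; rewrite ?invr_gt0 ?divr_gt0 ?oppr_gt0//.
  by rewrite vE; apply: plane_eq; rewrite !mxE; field; rewrite gt_eqF.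
- by apply: (@wedge C p p' s t).
(* aligned chords: both contain the segment from q to q + r t (p - q) *)
have vE' : p' - q = t *: (p - q) by rewrite vE s0 scale0r add0r.
have pq : p != q.
  by apply: contraTneq h => ->; rewrite /cross mulrC subrr ltxx.
pose r := (1 + t)^-1; have r0 : 0 < r by rewrite invr_gt0; lra.
have rE : r + r * t = 1 by rewrite /r; field; rewrite gt_eqF//; lra.
have rt : 0 < r * t by rewrite mulr_gt0.
have Bm : B (q + (r * t) *: (p - q)) by apply: cB => //; lra.
have Am : A (q + (r * t) *: (p - q)) by apply: cA => //; lra.
have Cm : C (q + (r * t) *: (p - q)).
  by rewrite -scalerA -vE'; apply: cC => //; lra.
have /eqP := @three_share_no_segment A B C a b c _ _ cA cB cC Aa Bb Cc AB BC AC Am Bm Cm Aq Bq Cq.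
rewrite -subr_eq0 addrAC subrr add0r scaler_eq0 subr_eq0 (negbTE pq) orbF.
by rewrite gt_eqF.
Qed.

End ConvexPlane.

(** * Euclidean distance, sup norm and segments *)

Section PlaneMetric.
Local Open Scope classical_set_scope.
Local Open Scope ring_scope.
Context {R : realType}.
Implicit Types (A B : set (plane R)) (x y z v w : plane R) (s t e : R).

Lemma norm_planeE x : `|x| = Num.max `|x 0 0| `|x 0 1|.
Proof.
have -> : `|x| = \big[Num.max/0]_ij `|x ij.1 ij.2| := mx_normrE x.
apply/le_anti/andP; split.
  apply/bigmax_leP; split=> /= [|[i j] _ /=]; first by rewrite le_max normr_ge0.
  by rewrite !ord1 le_max; have [->|->] := ord2P j; rewrite lexx ?orbT.
rewrite ge_max; apply/andP; split.
  exact: (le_bigmax _ (fun ij : 'I_1 * 'I_2 => `|x ij.1 ij.2|) (0, 0)).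
exact: (le_bigmax _ (fun ij : 'I_1 * 'I_2 => `|x ij.1 ij.2|) (0, 1)).
Qed.

Lemma edistE x y : edist x y = Num.sqrt ((x 0 0 - y 0 0) ^+ 2 + (x 0 1 - y 0 1) ^+ 2).
Proof.
rewrite /edist big_ord_recl big_ord1; congr (Num.sqrt (_ + (x _ _ - y _ _) ^+ 2));
  exact/val_inj.
Qed.

Lemma edist_ge0 x y : 0 <= edist x y. Proof. exact: sqrtr_ge0. Qed.

Lemma edist_sym x y : edist x y = edist y x.
Proof. by rewrite !edistE; congr Num.sqrt; ring. Qed.

Lemma edist_sqr x y : edist x y ^+ 2 = (x 0 0 - y 0 0) ^+ 2 + (x 0 1 - y 0 1) ^+ 2.
Proof. by rewrite edistE sqr_sqrtr// addr_ge0// sqr_ge0. Qed.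

Lemma edist_triangle y x z : edist x z <= edist x y + edist y z.
Proof.
rewrite -(@ler_pXn2r _ 2)// ?nnegrE ?addr_ge0 ?edist_ge0//.
rewrite edist_sqr; have := edist_sqr x y; have := edist_sqr y z.
have := edist_ge0 x y; have := edist_ge0 y z.
move: (edist x y) (edist y z) => a b b0 a0 bE aE.
set p := x 0 0 - y 0 0 in aE; set q := x 0 1 - y 0 1 in aE.
set r := y 0 0 - z 0 0 in bE; set s := y 0 1 - z 0 1 in bE.
have -> : x 0 0 - z 0 0 = p + r by rewrite /p /r; ring.
have -> : x 0 1 - z 0 1 = q + s by rewrite /q /s; ring.
(* Cauchy-Schwarz, from Lagrange's identity *)
have cs : p * r + q * s <= a * b.
  apply: le_trans (ler_norm _) _.
  rewrite -(@ler_pXn2r _ 2)// ?nnegrE ?mulr_ge0// real_normK ?num_real// exprMn aE bE.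
  rewrite -subr_ge0 (_ : _ - _ = (p * s - q * r) ^+ 2) ?sqr_ge0//; last by ring.
rewrite [leRHS]sqrrD aE bE mulr2n !sqrrD !mulr2n; lra.
Qed.

Lemma norm_le_edist x y : `|x - y| <= edist x y.
Proof.
rewrite norm_planeE ge_max !mxE edistE; apply/andP.
by split; rewrite -[X in X <= _]sqrtr_sqr; rewrite ler_sqrt ?addr_ge0 ?sqr_ge0// ?lerDl ?lerDr sqr_ge0.
Qed.

Lemma edist_le_norm x y : edist x y <= 2 * `|x - y|.
Proof.
have := lexx `|x - y|; rewrite {1}norm_planeE ge_max !mxE => /andP[h0 h1].
rewrite -ler_sqr ?nnegrE; [|exact: edist_ge0|by apply: mulr_ge0].
rewrite edist_sqr exprMn; move: h0 h1 => /(lerXn2r 2 (normr_ge0 _) (normr_ge0 _)).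
move=> h0 /(lerXn2r 2 (normr_ge0 _) (normr_ge0 _)); move: h0.
rewrite !real_normK ?num_real//; move: (`|x - y| ^+ 2) (sqr_ge0 `|x - y|) => n; lra.
Qed.

Lemma segment_continuous y w : continuous (fun t : R => y + t *: (w - y) : plane R).
Proof.
move=> t; apply: cvgD; first exact: cvg_cst.
by apply: cvgZr_tmp; exact: cvg_id.
Qed.

(** Connectedness of the segment: it cannot be split into two disjoint nonempty
    closed parts. *)
Lemma segment_crossing A B y w : closed A -> closed B -> A y -> B w ->
  (forall t, 0 <= t <= 1 -> A (y + t *: (w - y)) \/ B (y + t *: (w - y))) ->
  exists2 t, 0 <= t <= 1 & A (y + t *: (w - y)) /\ B (y + t *: (w - y)).
Proof.
move=> clA clB Ay Bw AB; apply: contrapT => none.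
pose g t : plane R := y + t *: (w - y).
have nAB t : 0 <= t <= 1 -> A (g t) -> B (g t) -> False.
  by move=> t01 At Bt; apply: none; exists t.
have cg : continuous g by exact: segment_continuous.
have E : [set t | 0 <= t <= 1 /\ A (g t)] = `[0, 1]%classic.
  apply: (@segment_connected R 0 1).
  - by exists 0; split; rewrite ?lexx ?ler01// /g scale0r addr0.
  - exists (g @^-1` ~` B); first by apply: open_comp => //; exact/closed_openC.
    apply/seteqP; split=> t /=; rewrite in_itv/= => -[t01 h]; split => //.
      by move=> Bt; apply: (nAB t).
    by case: (AB t).
  - exists (g @^-1` A); first by apply: closed_comp.
    by apply/seteqP; split=> t /=; rewrite in_itv/=.
have : `[0, 1]%classic (1 : R) by rewrite /= in_itv/= lexx ler01.
rewrite -E => -[_ A1]; apply: (nAB 1); rewrite ?lexx ?ler01//.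
by rewrite /g scale1r addrC subrK.
Qed.

End PlaneMetric.

(** * Two convex sets covering a neighbourhood of a common point *)

Section TwoTiles.
Local Open Scope classical_set_scope.
Local Open Scope ring_scope.
Context {R : realType}.
Implicit Types (A B : set (plane R)) (x y z v w : plane R) (s t e : R).

(** If [x + v] is in [A] and [x - v] is not in [B], then [A] alone covers a
    neighbourhood of [x - v], and the midpoint [x] of [x - v] and [x + v] is
    interior to [A] although it belongs to [B]. *)
Lemma half_turn_mem A B x v e : convex A -> closed B -> A° `&` B = set0 ->
  B x -> (forall y, `|y - x| < e -> A y \/ B y) ->
  `|v| < e -> A (x + v) -> B (x - v).
Proof.
move=> cA clB AB Bx near ve Av; apply: contrapT => nBv.
have : (~` B)° (x - v) by apply: open_nbhs_nbhs; split => //; exact/closed_openC.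
move=> /interior_normP[d d0 dB].
have Av' : A° (x - v).
  apply/interior_normP; exists (Num.min d (e - `|v|)).
    by rewrite lt_min d0 subr_gt0.
  move=> y; rewrite lt_min => /andP[yd ye]; case: (near y) => // [|By].
    rewrite (_ : y - x = y - (x - v) - v); last by apply: plane_eq; rewrite !mxE; ring.
    by rewrite (le_lt_trans (ler_normB _ _))// -ltrBrDr.
  by have := dB _ yd.
suff : set0 x by [].
rewrite -AB; split => //.
rewrite (_ : x = (x + v) + 2^-1 *: ((x - v) - (x + v))).
  by apply: convex_interior => //; lra.
by apply: plane_eq; rewrite !mxE; field.
Qed.

(** A point that only two tiles share is in the middle of a common segment, so
    it is not an end of their intersection.  The half turn around [x] exchanges
    the parts of [A] and [B] close to [x], so it is enough to find one common
    point other than [x].  A path from a point of [A] to the opposite point,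
    which is in [B], that avoids [x] meets such a point. *)
Lemma two_tiles_chord A B x e : convex A -> convex B -> closed A -> closed B ->
  A° `&` B = set0 -> B° `&` A = set0 -> A° !=set0 -> A x -> B x -> 0 < e ->
  (forall y, `|y - x| < e -> A y \/ B y) ->
  exists2 v, v != 0 & [/\ A (x + v), A (x - v), B (x + v) & B (x - v)].
Proof.
move=> cA cB clA clB AB BA [a Aa] Ax Bx e0 near.
have near' y : `|y - x| < e -> B y \/ A y by move/near/or_comm.
have ax : a - x != 0.
  rewrite subr_eq0; apply/eqP => ax; suff : set0 x by [].
  by rewrite -AB; split => //; rewrite -ax.
pose m := `|a - x|; have m0 : 0 < m by rewrite normr_gt0.
pose s := e / (e + m); have em : 0 < e + m by rewrite addr_gt0.
have s0 : 0 < s by rewrite divr_gt0.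
have s1 : s <= 1 by rewrite ler_pdivrMr// mul1r lerDl ltW.
pose v := s *: (a - x).
have v0 : v != 0 by rewrite scaler_eq0 negb_or gt_eqF.
have ve : `|v| < e.
  by rewrite normrZ gtr0_norm// -/m /s mulrAC ltr_pdivrMr// ltr_pM2l// ltrDr.
have Av : A (x + v) by apply: cA => //; [exact: interior_subset | rewrite s1 ltW].
have Bv : B (x - v) by exact: (half_turn_mem A B _ _ e).
clearbody v.
(* a quarter turn of v: the path x + v, x + w, x - v avoids x *)
pose w : plane R := \row_i (if i == 0 then - v 0 1 else v 0 0).
have w0 : w 0 0 = - v 0 1 by rewrite mxE.
have w1 : w 0 1 = v 0 0 by rewrite mxE.
clearbody w.
have we : `|w| < e.
  by rewrite norm_planeE w0 w1 normrN maxC -norm_planeE.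
have indep (k l : R) : k *: v + l *: w = 0 -> k = 0 /\ l = 0.
  move=> kl.
  have n0 : v 0 0 ^+ 2 + v 0 1 ^+ 2 != 0.
    apply: contra v0; rewrite paddr_eq0 ?sqr_ge0// !sqrf_eq0 => /andP[/eqP h /eqP h'].
    by apply/eqP/plane_eq; rewrite ?h ?h' mxE.
  have := congr1 (fun M : plane R => M 0 0) kl.
  have := congr1 (fun M : plane R => M 0 1) kl.
  rewrite !mxE w0 w1 => k1 k0; split; apply: (mulIf n0); rewrite mul0r.
    transitivity (v 0 0 * (k * v 0 0 + l * - v 0 1) + v 0 1 * (k * v 0 1 + l * v 0 0)).
      by ring.
    by rewrite k0 k1; ring.
  transitivity (v 0 0 * (k * v 0 1 + l * v 0 0) - v 0 1 * (k * v 0 0 + l * - v 0 1)).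
    by ring.
  by rewrite k0 k1; ring.
have finish (z : plane R) : z != 0 -> `|z| < e -> A (x + z) -> B (x + z) ->
    exists2 v, v != 0 & [/\ A (x + v), A (x - v), B (x + v) & B (x - v)].
  move=> z0 ze Az Bz; exists z => //; split => //.
    exact: (half_turn_mem B A _ _ e).
  exact: (half_turn_mem A B _ _ e).
have nearD (z : plane R) : `|z| < e -> A (x + z) \/ B (x + z).
  by move=> ze; apply: near; rewrite addrAC subrr add0r.
have cvx (y z : plane R) t : `|y| < e -> `|z| < e -> 0 <= t <= 1 -> `|y + t *: (z - y)| < e.
  move=> ye ze /andP[t0 t1].
  rewrite (_ : _ + _ = (1 - t) *: y + t *: z); last first.
    by apply: plane_eq; rewrite !mxE; ring.
  apply: le_lt_trans (ler_normD _ _) _; rewrite !normrZ ger0_norm ?subr_ge0// ger0_norm//.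
  pose m' := Num.max `|y| `|z|.
  have ym : `|y| <= m' by rewrite le_max lexx.
  have zm : `|z| <= m' by rewrite le_max lexx orbT.
  have m'e : m' < e by rewrite gt_max ye ze.
  apply: le_lt_trans m'e; rewrite [leRHS](_ : _ = (1 - t) * m' + t * m'); last by ring.
  by rewrite lerD// ler_wpM2l// subr_ge0.
have cross_from (y z : plane R) : `|y| < e -> `|z| < e -> A (x + y) -> B (x + z) ->
    exists2 t, 0 <= t <= 1 & A (x + (y + t *: (z - y))) /\ B (x + (y + t *: (z - y))).
  move=> ye ze Ay Bz.
  have E t : x + (y + t *: (z - y)) = (x + y) + t *: ((x + z) - (x + y)).
    by apply: plane_eq; rewrite !mxE; ring.
  have cover t : 0 <= t <= 1 -> A ((x + y) + t *: ((x + z) - (x + y))) \/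
      B ((x + y) + t *: ((x + z) - (x + y))).
    by move=> t01; rewrite -E; apply: nearD; exact: cvx.
  have [t t01] := segment_crossing _ _ _ _ clA clB Ay Bz cover.
  by rewrite -E; exists t.
have nve : `|- v| < e by rewrite normrN.
have [Aw|Bw] := nearD _ we.
  have [t t01 [At Bt]] := cross_from _ _ we nve Aw Bv.
  apply: (finish _ _ _ At Bt); last exact: cvx.
  apply/eqP => h; have [] := indep (- t) (1 - t); last by lra.
  by rewrite -h; apply: plane_eq; rewrite !mxE; ring.
have [t t01 [At Bt]] := cross_from _ _ ve we Av Bw.
apply: (finish _ _ _ At Bt); last exact: cvx.
apply/eqP => h; have [] := indep (1 - t) t; last by lra.
by rewrite -h; apply: plane_eq; rewrite !mxE; ring.
Qed.

End TwoTiles.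

(** * Normal tilings by convex tiles *)

Section ConvexTiling.
Local Open Scope classical_set_scope.
Local Open Scope ring_scope.
Context {R : realType}.
Implicit Types (T : set (set (plane R))) (A B C : set (plane R)).
Implicit Types (x y z c p q M : plane R) (r s t u U : R).

(** Of normality and of the polygonal shape of the tiles, only these metric
    consequences are used below; [u] is measured with the sup norm, which the
    topology of the plane is built on. *)
Record convex_tiling T u U : Prop := ConvexTiling {
  ct_tiling : tiling T;
  ct_u : 0 < u;
  ct_U : 0 < U;
  ct_convex : forall A, T A -> convex A;
  ct_fat : forall A, T A -> exists c, forall y, `|y - c| < u -> A y;
  ct_diam : forall A x y, T A -> A x -> A y -> edist x y <= U }.

Lemma convex_ngon_convex n A : convex_ngon n A -> convex A.
Proof.
move=> [p [_ ->]] x y t hx hy /andP[t0 t1] C [cC pC].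
have Cx := hx C (conj cC pC); have Cy := hy C (conj cC pC).
have := cC y x (Itv01 t0 t1) (mem_set Cy) (mem_set Cx); rewrite inE.
congr C; rewrite /conv /=.
by apply: plane_eq; rewrite !mxE /unstable.onem; ring.
Qed.

Lemma normal_convex_tiling n T : normal_tiling T ->
  (forall A, T A -> convex_ngon n A) -> exists u U, convex_tiling T u U.
Proof.
move=> [tT _ _ [u [U [u0 U0 uU]]]] gon; exists (u / 2), (2 * U); split => //.
- by rewrite divr_gt0.
- by rewrite mulr_gt0.
- by move=> A /gon; exact: convex_ngon_convex.
- move=> A /uU[[c cA] _]; exists c => y yc; apply: cA; rewrite /disk/=.
  by apply: le_trans (edist_le_norm _ _) _; lra.
- move=> A x y /uU[_ [c Ac]] /Ac xc /Ac yc; apply: le_trans (edist_triangle c _ _) _.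
  by rewrite (edist_sym c); rewrite /disk/= in xc yc; lra.
Qed.

Lemma three_tiles_vertex T A B C x : T A -> T B -> T C ->
  A <> B -> B <> C -> A <> C -> A x -> B x -> C x -> is_vertex T x.
Proof.
move=> TA TB TC /eqP AB /eqP BC /eqP AC Ax Bx Cx.
have s3 : ([set` [fset D in [:: A; B; C]]%fset] #= `I_3)%card.
  apply/card_eq_fsetP; rewrite card_fseq undup_id//=.
  by rewrite !inE negb_or AB AC BC.
have [_ h] := (card_eqPle _ _).1 s3; apply: card_le_trans h _.
by apply: subset_card_le => D /=; rewrite !inE => /orP[/eqP->|/orP[/eqP->|/orP[/eqP->|]]]//; split.
Qed.

Section Fixed.
Variables (T : set (set (plane R))) (u U : R).
Hypothesis cT : convex_tiling T u U.

Lemma tile_interior A : T A -> A° !=set0.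
Proof.
move=> /(ct_fat _ _ _ cT)[c cA]; exists c; apply/interior_normP.
by exists u => //; exact: (ct_u _ _ _ cT).
Qed.

Lemma tile_closed A : T A -> closed A.
Proof. by have [h _ _] := ct_tiling _ _ _ cT => /h. Qed.

Lemma tile_disjoint A B : T A -> T B -> A <> B -> A° `&` B = set0.
Proof.
move=> TA TB AB; have [b Bb] := tile_interior _ TB.
apply: interior_disjoint (ct_convex _ _ _ cT _ TA) (ct_convex _ _ _ cT _ TB) Bb _.
by have [_ _ h] := ct_tiling _ _ _ cT; exact: h.
Qed.

Definition tiles_meeting M r := [set A | T A /\ A `&` disk r M !=set0].

Lemma bounded_ncard (X : choiceType) (S : set X) n :
  (forall B : {fset X}, [set` B] `<=` S -> (#|` B| <= n)%N) ->
  finite_set S /\ (ncard S <= n)%N.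
Proof.
move=> h; have fS : finite_set S.
  apply: contrapT => /(infinite_set_fset n.+1)[B BS]; rewrite leqNgt ltnS.
  by rewrite h.
by split => //; apply: h; rewrite fset_setK.
Qed.

(** A tile contains an open square of side [2 u], hence an interior point of the
    square lattice of mesh [u]; distinct tiles receive distinct lattice points,
    and a disk of radius [r + U] has at most quadratically many of them.  This
    also shows that the tiling is locally finite. *)
Lemma tiles_meeting_card M r : 0 <= r ->
  finite_set (tiles_meeting M r) /\
  ((ncard (tiles_meeting M r))%:R <= (2 / u * r + (2 * U / u + 1)) ^+ 2 :> R).
Proof.
move=> r0; have u0 := ct_u _ _ _ cT; have U0 := ct_U _ _ _ cT.
pose W := r + U; pose K := (Num.truncn (2 * W / u)).+1.
have W0 : 0 <= W by rewrite addr_ge0// ltW.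
have [ctr ctrP] : exists f : set (plane R) -> plane R,
    forall A, T A -> forall y, `|y - f A| < u -> A y.
  have /choice[f fP] : forall A, exists c, T A -> forall y, `|y - c| < u -> A y.
    move=> A; have [TA|nTA] := pselect (T A); last by exists 0.
    by have [c cA] := ct_fat _ _ _ cT _ TA; exists c.
  by exists f.
pose k A i := Num.truncn ((ctr A 0 i - M 0 i + W) / u).
have kP A i : tiles_meeting M r A ->
    0 <= ctr A 0 i - M 0 i + W <= 2 * W.
  move=> [TA [y [Ay yM]]].
  have Ac : A (ctr A) by apply: ctrP => //; rewrite subrr normr0.
  have : `|ctr A - M| <= W.
    apply: le_trans (norm_le_edist _ _) _; apply: le_trans (edist_triangle y _ _) _.
    by rewrite addrC lerD//; exact: (ct_diam _ _ _ cT A).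
  rewrite norm_planeE ge_max !mxE => /andP[].
  rewrite !ler_norml => /andP[a b] /andP[d e].
  by have [->|->] := ord2P i; lra.
have [|fin card] := @bounded_ncard _ (tiles_meeting M r) (K * K).
  move=> B BS.
  pose f A : 'I_K * 'I_K := (inord (k A 0), inord (k A 1)).
  have kK A i : tiles_meeting M r A -> (k A i < K)%N.
    move=> /kP-/(_ i)/andP[h0 h1]; rewrite ltnS /k le_truncn//.
    by rewrite ler_pM2r// invr_gt0.
  have inj : {in B &, injective f}.
    move=> A A' /BS SA /BS SA' [].
    move=> /(congr1 val); rewrite /= !inordK ?kK// => k0.
    move=> /(congr1 val); rewrite /= !inordK ?kK// => k1.
    apply: contrapT => AA'.
    pose g : plane R := \row_i (M 0 i - W + u * (k A i)%:R).
    have near D : tiles_meeting M r D -> k D 0 = k A 0 -> k D 1 = k A 1 ->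
        `|g - ctr D| < u.
      move=> SD e0 e1.
      have coord i : k D i = k A i -> `|g 0 i - ctr D 0 i| < u.
        move=> ei; rewrite mxE -ei /k distrC.
        have /andP[h0 h1] := kP _ i SD.
        have := truncn_itv (divr_ge0 h0 (ltW u0)).
        rewrite ler_pdivlMr// ltr_pdivrMr// => /andP[].
        set n := Num.truncn _; rewrite -natr1 => a b.
        by rewrite ltr_norml; apply/andP; split; lra.
      rewrite norm_planeE gt_max !mxE.
      have := coord 0 e0; have := coord 1 e1; rewrite !mxE => -> ->.
      by [].
    suff : set0 g by [].
    rewrite -(tile_disjoint _ _ SA.1 SA'.1 AA'); split.
      apply/interior_normP; exists (u - `|g - ctr A|).
        by rewrite subr_gt0 near.
      move=> y yg; apply: (ctrP _ SA.1).
      rewrite -(subrK g y) -addrA; apply: le_lt_trans (ler_normD _ _) _.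
      by rewrite -ltrBrDr.
    by apply: (ctrP _ SA'.1); apply: near.
  have -> : (K * K = #|{: 'I_K * 'I_K}|)%N by rewrite card_prod !card_ord.
  rewrite -(size_map f); apply: leq_trans (max_card (mem (map f B))).
  by rewrite (card_uniqP _)// map_inj_in_uniq// fset_uniq.
split => //; apply: le_trans (_ : (K * K)%:R <= _); first by rewrite ler_nat.
have rhs0 : 0 <= 2 / u * r + (2 * U / u + 1).
  have ui : 0 <= u^-1 by rewrite invr_ge0 ltW.
  by rewrite !addr_ge0 ?mulr_ge0// ltW.
rewrite natrM -expr2; apply: lerXn2r; rewrite ?nnegrE//.
rewrite /K -natr1 [leRHS](_ : _ = 2 * W / u + 1); last by rewrite /W; field; rewrite gt_eqF.
by rewrite lerD2r truncn_le divr_ge0// ?mulr_ge0// ltW.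
Qed.

End Fixed.
End ConvexTiling.

(** * A tile has at most as many adjacents as vertices *)

Section Adjacency.
Local Open Scope classical_set_scope.
Local Open Scope ring_scope.
Context {R : realType}.
Implicit Types (A B C : set (plane R)).
Implicit Types (x y z c p q M : plane R) (r s t : R).
Variables (T : set (set (plane R))) (u U : R).
Hypothesis cT : convex_tiling T u U.

Let convexT A (TA : T A) : convex A := ct_convex _ _ _ cT A TA.
Let closedT A (TA : T A) : closed A := tile_closed _ _ _ cT A TA.
Let disjT A B (TA : T A) (TB : T B) (AB : A <> B) : A° `&` B = set0 :=
  tile_disjoint _ _ _ cT A B TA TB AB.

(** By local finiteness the union of the nearby tiles that miss [x] is closed. *)
Lemma non_vertex_near A B x : T A -> T B -> A <> B -> A x -> B x ->
  ~ is_vertex T x ->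
  exists2 e : R, 0 < e & forall y, `|y - x| < e -> A y \/ B y.
Proof.
move=> TA TB AB Ax Bx nv.
have [fin _] := tiles_meeting_card _ _ _ cT x 2 (ler0n _ 2).
pose far := [set C | tiles_meeting T x 2 C /\ ~ C x].
have clF : closed (\bigcup_(C in far) C).
  apply: closed_bigcup; first by apply: sub_finite_set fin => C [].
  by move=> C [[TC _] _]; exact: closedT.
have : (~` \bigcup_(C in far) C)° x.
  apply: open_nbhs_nbhs; split; first exact/closed_openC.
  by move=> [C [_ nCx] Cx].
move=> /interior_normP[e e0 eF]; exists (Num.min e 1); first by rewrite lt_min e0 ltr01.
move=> y; rewrite lt_min => /andP[ye y1].
have [_ cov _] := ct_tiling _ _ _ cT.
have : setT y by [].
rewrite -cov => -[C TC Cy].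
have Cx : C x.
  apply: contrapT => nCx; apply: (eF y ye); exists C => //; split => //; split => //.
  by exists y; split => //; rewrite /disk/=; apply: le_trans (edist_le_norm _ _) _; lra.
have [CA|CA] := pselect (C = A); first by left; rewrite -CA.
have [CB|CB] := pselect (C = B); first by right; rewrite -CB.
exfalso; apply: nv; apply: (three_tiles_vertex _ A B C x) => // h; [exact: CB (esym h)|exact: CA (esym h)].
Qed.

Lemma non_vertex_chord A B x : T A -> T B -> A <> B -> A x -> B x ->
  ~ is_vertex T x ->
  exists2 v, v != 0 & [/\ A (x + v), A (x - v), B (x + v) & B (x - v)].
Proof.
move=> TA TB AB Ax Bx /(non_vertex_near _ _ _ TA TB AB Ax Bx)[e e0 near].
apply: (two_tiles_chord A B x e) => //; try exact: convexT; try exact: closedT.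
- exact: disjT.
- by apply: disjT => // /esym.
- exact: tile_interior cT _ TA.
Qed.

(** The point that selects the edge as a connected component for [A] is not a
    vertex, and it lies in [B] because the whole edge does. *)
Lemma adjacent_common_point A B : adjacent T A B ->
  exists x, [/\ A x, B x & ~ is_vertex T x].
Proof.
move=> [TA TB _ [E [[x [[clAx intAx] nv] EA] [y _ EB]]]].
exists x; split => //.
  by rewrite (closure_id A).1//; exact: closedT.
have : E x by rewrite EA; apply: subset_closure; exact: connected_component_refl.
rewrite EB => Ex; rewrite (closure_id B).1; last exact: closedT.
have {}Ex : closure (closure B) x.
  apply: closure_subset Ex => z /connected_component_sub[[clBz _] _]; exact: clBz.
by rewrite -(closure_id _).1// in Ex; exact: closed_closure.
Qed.

(** The tiles [A] and [B] meet in a segment, by [common_collinear], which is not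
    reduced to a point, by [non_vertex_chord].  Its counterclockwise end [q], as
    seen from [c], is a vertex, since any other common point is in the middle of
    a common segment. *)
Lemma adjacent_head A B c : adjacent T A B -> A° c ->
  exists p q, [/\ A p, B p, A q, B q & is_vertex T q /\ 0 < cross (p - c) (q - c)].
Proof.
move=> adj Ac; have [TA TB AB _] := adj.
have [x [Ax Bx nvx]] := adjacent_common_point _ _ adj.
have [v0 v0n [Axv Axv' Bxv Bxv']] := non_vertex_chord _ _ _ TA TB AB Ax Bx nvx.
have [cA cB] := (convexT _ TA, convexT _ TB); have dAB := disjT _ _ TA TB AB.
have crE (w : plane R) : cross (x - c) (x + w - c) = cross (x - c) w.
  by rewrite /cross !mxE; ring.
have [v [vn Av Bv vc]] : exists v, [/\ v != 0, A (x + v), B (x + v) & 0 < cross (x - c) v].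
  have : cross (x - c) v0 != 0.
    rewrite -crE; apply: (cross_chord A B) => //.
    by rewrite -subr_eq0 opprD addrA subrr sub0r oppr_eq0.
  rewrite neq_lt => /orP[neg|pos]; last by exists v0.
  exists (- v0); split; rewrite ?oppr_eq0//.
  by move: neg; rewrite -oppr_gt0; congr (_ < _); rewrite /cross !mxE; ring.
(* v points counterclockwise along the common segment, and f increases with it *)
pose f y : R := y 0 0 * v 0 0 + y 0 1 * v 0 1.
have fv : 0 < f v.
  rewrite lt_neqAle addr_ge0 -?expr2 ?sqr_ge0// andbT eq_sym /f -!expr2.
  apply: contra vn; rewrite paddr_eq0 ?sqr_ge0// !sqrf_eq0 => /andP[/eqP h /eqP h'].
  by apply/eqP/plane_eq; rewrite ?h ?h' mxE.
have fD y z : f (y + z) = f y + f z by rewrite /f !mxE; ring.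
have fZ k y : f (k *: y) = k * f y by rewrite /f !mxE; ring.
have aligned z : A z -> B z -> exists k, z = x + k *: v.
  move=> Az Bz.
  have := common_collinear A B c x (x + v) z cA cB dAB Ac Ax Av Az Bx Bv Bz.
  rewrite addrAC subrr add0r => /(cross_collinear _ _ vn)[k kE].
  by exists k; rewrite -kE addrC subrK.
have [q] : exists2 q, q \in A `&` B & forall z, z \in A `&` B -> f z <= f q.
  apply: EVT_max_rV; first by exists x.
    apply: bounded_closed_compact; last first.
      by apply: closedI; exact: closedT.
    exists (`|x| + U); split; first exact: num_real.
    move=> M /ltW lM z /= [Az _]; apply: le_trans lM.
    rewrite -(subrK x z) addrC; apply: le_trans (ler_normD _ _) _.
    rewrite lerD2l; apply: le_trans (norm_le_edist _ _) _.
    exact: (ct_diam _ _ _ cT A).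
  apply: continuous_subspaceT => z.
  have cc i : (fun y : plane R => y 0 i) y @[y --> z] --> z 0 i by exact: coord_continuous.
  exact: (cvgD (cvgM (cc 0) (cvg_cst _)) (cvgM (cc 1) (cvg_cst _))).
rewrite inE => -[Aq Bq] qmax.
have {}qmax z : A z -> B z -> f z <= f q by move=> Az Bz; apply: qmax; rewrite inE.
have [k qE] := aligned _ Aq Bq.
have k0 : 0 < k.
  have := qmax _ Av Bv; rewrite qE !fD fZ lerD2l -subr_ge0 -{2}(mul1r (f v)) -mulrBl.
  by rewrite pmulr_lge0// subr_ge0; exact: lt_le_trans.
exists x, q; split => //; split; last first.
  rewrite {1}qE crE (_ : cross _ _ = k * cross (x - c) v) ?mulr_gt0//.
  by rewrite /cross !mxE; ring.
apply: contrapT => nvq.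
have [w wn [Aw Aw' Bw Bw']] := non_vertex_chord _ _ _ TA TB AB Aq Bq nvq.
have fw : f w = 0.
  apply/le_anti/andP; split.
    by have := qmax _ Aw Bw; rewrite fD gerDl.
  by have := qmax _ Aw' Bw'; rewrite fD -scaleN1r fZ mulN1r gerDl oppr_le0.
have [l wE] : exists l, w = l *: v.
  have [l lE] := aligned _ Aw Bw; exists (l - k).
  by rewrite scalerBl -[w](addKr q) lE qE opprD addrACA addNr add0r addrC.
move: fw wn; rewrite wE fZ => /eqP; rewrite mulf_eq0 (gt_eqF fv) orbF => /eqP->.
by rewrite scale0r eqxx.
Qed.

(** The vertices are the heads of the chords that [A] shares with its adjacents;
    they are distinct by [chord_head_inj]. *)
Lemma adjacents_vertices h A : T A -> has_adjacents T h A ->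
  exists s : seq (plane R), [/\ uniq s, size s = h &
    forall x, x \in s -> A x /\ is_vertex T x].
Proof.
move=> TA hA; have [c Ac] := tile_interior _ _ _ cT _ TA.
have fin : finite_set [set B | adjacent T A B] by apply/finite_setP; exists h.
have /choice[g gP] : forall B, exists q, adjacent T A B ->
    [/\ A q, B q, is_vertex T q & exists p, [/\ A p, B p & 0 < cross (p - c) (q - c)]].
  move=> B; have [adj|nadj] := pselect (adjacent T A B); last by exists 0.
  have [p [q [Ap Bp Aq Bq [vq pq]]]] := adjacent_head _ _ _ adj Ac.
  by exists q => _; split => //; exists p.
exists [seq g B | B <- fset_set [set B | adjacent T A B]]; split.
- rewrite map_inj_in_uniq ?fset_uniq// => B C.
  rewrite !in_fset_set// !inE => /= AB AC gBC.
  apply: contrapT => BC.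
  have [Aq Bq _ [p [Ap Bp pc]]] := gP _ AB.
  have [_ Cq _ [p' [Ap' Cp' pc']]] := gP _ AC; rewrite -gBC in Cq pc'.
  have [[_ TB nAB _] [_ TC nAC _]] := (AB, AC).
  have [b Bb] := tile_interior _ _ _ cT _ TB; have [d Cd] := tile_interior _ _ _ cT _ TC.
  apply: (chord_head_inj A B C c b d p p' (g B)) => //;
    by first [exact: convexT | exact: disjT].
- by rewrite size_map (card_fset_set hA).
- move=> x /mapP[B]; rewrite in_fset_set// inE => /= AB ->.
  by have [] := gP _ AB.
Qed.
End Adjacency.

(** * Counting incidences between vertices and tiles *)

Section ValenceCount.
Local Open Scope classical_set_scope.
Local Open Scope ring_scope.
Context {R : realType}.
Implicit Types (A B C : set (plane R)).
Implicit Types (x y z c p q M : plane R) (r s t tau : R).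
Variables (T : set (set (plane R))) (u U : R).
Hypothesis cT : convex_tiling T u U.

Lemma sum_asbool (X : eqType) (s : seq X) (P : X -> Prop) :
  (\sum_(a <- s) `[< P a >] = size [seq a <- s | `[< P a >]])%N.
Proof.
rewrite size_filter -sum1_count [RHS]big_mkcond.
by apply: eq_bigr => a _; case: asboolP.
Qed.

(** A linear form, thought of as an altitude. *)
Definition height tau x : R := x 0 0 + tau * x 0 1.

(** Two given points have the same height for at most one value of [tau]. *)
Lemma generic_height (V : seq (plane R)) :
  exists tau, {in V &, injective (height tau)}.
Proof.
pose L := [seq - (x 0 0 - y 0 0) / (x 0 1 - y 0 1) | x <- V, y <- V].
exists (1 + \sum_(b <- L) `|b|) => x y xV yV; set tau := 1 + _ => xy.
have [x1|x1] := eqVneq (x 0 1) (y 0 1).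
  apply: plane_eq => //; move: xy; rewrite /height x1; exact: addIr.
have bL : - (x 0 0 - y 0 0) / (x 0 1 - y 0 1) \in L.
  by apply/allpairsP; exists (x, y).
have bE : tau = - (x 0 0 - y 0 0) / (x 0 1 - y 0 1).
  have d0 : x 0 1 - y 0 1 != 0 by rewrite subr_eq0.
  by apply: (mulIf d0); rewrite divfK//; move: xy; rewrite /height; lra.
rewrite -bE in bL.
have : tau <= \sum_(b <- L) `|b|.
  rewrite (big_rem tau bL)/=; apply: le_trans (ler_norm _) _.
  by rewrite lerDl sumr_ge0.
by rewrite /tau gerDr leNgt ltr01.
Qed.

Definition lowest tau A x := forall y, A y -> height tau x <= height tau y.
Definition highest tau A x := forall y, A y -> height tau y <= height tau x.

Lemma heightD tau x y t : height tau (x + t *: (y - x)) =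
  height tau x + t * (height tau y - height tau x).
Proof. by rewrite /height !mxE; ring. Qed.

Lemma level_interior tau A x : T A -> ~ lowest tau A x -> ~ highest tau A x ->
  exists2 c, A° c & height tau c = height tau x.
Proof.
move=> TA /existsNP[a /not_implyP[Aa /negP]]; rewrite -ltNge => ax.
move=> /existsNP[b /not_implyP[Ab /negP]]; rewrite -ltNge => xb.
have [i Ai] := tile_interior _ _ _ cT _ TA.
have cA := ct_convex _ _ _ cT _ TA.
pose t y := (height tau x - height tau y) / (height tau i - height tau y).
have key y : A y -> 0 < t y <= 1 -> height tau i != height tau y ->
    exists2 c, A° c & height tau c = height tau x.
  move=> Ay ty iy; exists (y + t y *: (i - y)); first exact: convex_interior.
  by rewrite heightD /t divfK ?subr_eq0// addrC subrK.
have [ix|ix] := lerP (height tau x) (height tau i).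
  apply: (key a) => //; last by rewrite gt_eqF// (lt_le_trans ax).
  have d0 : 0 < height tau i - height tau a by lra.
  apply/andP; split; first by rewrite /t divr_gt0// subr_gt0.
  by rewrite /t ler_pdivrMr//; lra.
apply: (key b) => //; last by rewrite lt_eqF// (lt_trans ix).
have d0 : 0 < height tau b - height tau i by lra.
have -> : t b = (height tau b - height tau x) / (height tau b - height tau i).
  by rewrite /t -[RHS]divrNN !opprB.
apply/andP; split; first by rewrite divr_gt0// subr_gt0.
by rewrite ler_pdivrMr//; lra.
Qed.

Lemma level_point tau x c : height tau c = height tau x ->
  c - x = (c 0 1 - x 0 1) *: (\row_i (if i == 0 then - tau else 1)).
Proof.
rewrite /height => h; apply: plane_eq; rewrite !mxE/=; last by rewrite mulr1.
by lra.
Qed.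

(** On the level line of [x], on one side of [x], say that the interior point [c]
    of [A] is closer to [x] than the interior point [d] of [B]: it is then
    between [x] and [d], hence in [B]. *)
Lemma level_side tau A B x c d : T A -> T B -> A <> B -> A x -> B x ->
  A° c -> B° d -> height tau c = height tau x -> height tau d = height tau x ->
  0 < (c 0 1 - x 0 1) * (d 0 1 - x 0 1) -> False.
Proof.
wlog : A B c d / `|c 0 1 - x 0 1| <= `|d 0 1 - x 0 1|.
  move=> wl TA TB AB Ax Bx Ac Bd hc hd cd.
  have [h|/ltW h] := lerP `|c 0 1 - x 0 1| `|d 0 1 - x 0 1|.
    exact: (wl A B c d).
  by apply: (wl B A d c) => //; [move/esym|rewrite mulrC].
move=> le TA TB AB Ax Bx Ac Bd /level_point hc /level_point hd cd.
set k := c 0 1 - x 0 1 in le hc cd; set l := d 0 1 - x 0 1 in le hd cd.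
have l0 : l != 0 by apply: contraTneq cd => ->; rewrite mulr0 ltxx.
have kl0 : 0 < k / l.
  have := cd; rewrite -(pmulr_lgt0 _ (_ : 0 < l^-1 ^+ 2)); last first.
    by rewrite lt0r sqr_ge0 sqrf_eq0 invr_eq0 l0.
  by rewrite (_ : _ * _ ^+ 2 = k / l)//; field.
have kl1 : k / l <= 1.
  by apply: le_trans (ler_norm _) _; rewrite normrM normfV ler_pdivrMr ?normr_gt0// mul1r.
have cE : c = x + (k / l) *: (d - x).
  by rewrite hd scalerA divfK// -hc addrC subrK.
suff : set0 c by [].
rewrite -(tile_disjoint _ _ _ cT _ _ TA TB AB); split => //.
apply: interior_subset; rewrite cE; apply: convex_interior => //; last by rewrite kl0.
exact: ct_convex cT _ TB.
Qed.

(** A tile at [x] that neither starts nor ends there has an interior point on the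
    level line of [x]; by [level_side] there is at most one such tile on the
    left of [x] and at most one on the right. *)
Lemma middle_tiles tau x (Q : seq (set (plane R))) : uniq Q ->
  (forall A, A \in Q -> T A) ->
  (\sum_(A <- Q) `[< [/\ A x, ~ lowest tau A x & ~ highest tau A x] >] <= 2)%N.
Proof.
move=> uQ QT.
pose P A := `[< [/\ A x, ~ lowest tau A x & ~ highest tau A x] >].
rewrite sum_asbool -/P.
pose side A := `[< exists c, [/\ A° c, height tau c = height tau x & x 0 1 < c 0 1] >].
rewrite -(size_map side); apply: (@leq_trans #|{: bool}|); last by rewrite card_bool.
have inj : {in [seq A <- Q | P A] &, injective side}.
  move=> A B; rewrite !mem_filter => /andP[/asboolP[Ax lA hA] /QT TA].
  move=> /andP[/asboolP[Bx lB hB] /QT TB] AB; apply: contrapT => nAB.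
  have nx (C D : set (plane R)) c : T C -> T D -> C <> D -> D x -> C° c ->
      height tau c = height tau x -> c 0 1 != x 0 1.
    move=> TC TD CD Dx Cc hc; apply/eqP => c1; suff : set0 x by [].
    rewrite -(tile_disjoint _ _ _ cT _ _ TC TD CD); split => //.
    suff <- : c = x by [].
    by apply: plane_eq => //; move: hc; rewrite /height c1; exact: addIr.
  have [c Ac hc] := level_interior _ _ _ TA lA hA.
  have [d Bd hd] := level_interior _ _ _ TB lB hB.
  have nBA : B <> A by move/esym.
  have := nx _ _ _ TA TB nAB Bx Ac hc; have := nx _ _ _ TB TA nBA Ax Bd hd.
  have [sA|sA] := boolP (side A).
    have sB : side B by rewrite -AB.
    have /asboolP[c' [Ac' hc' c1]] := sA; have /asboolP[d' [Bd' hd' d1]] := sB.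
    move=> _ _; apply: (level_side tau A B x c' d') => //.
    by rewrite mulr_gt0// subr_gt0.
  have sB : ~~ side B by rewrite -AB.
  rewrite !neq_lt => /orP[d1|d1]; last by move/asboolP: sB; case; exists d.
  move=> /orP[c1|c1]; last by move/asboolP: sA; case; exists c.
  apply: (level_side tau A B x c d) => //.
  by rewrite -mulrNN !opprB mulr_gt0// subr_gt0.
apply: leq_trans (max_card (mem (map side [seq A <- Q | P A]))).
by rewrite (card_uniqP _)// map_inj_in_uniq// filter_uniq.
Qed.

Lemma sum_asbool_le1 (X : eqType) (V : seq X) (P : X -> Prop) : uniq V ->
  (forall a b : X, a \in V -> b \in V -> P a -> P b -> a = b) ->
  (\sum_(a <- V) `[< P a >] <= 1)%N.
Proof.
move=> uV; elim: V uV => [|x V IH] /=; first by rewrite big_nil.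
move=> /andP[xV uV] inj; rewrite big_cons.
have [Px|nPx] := asboolP (P x).
  rewrite big_seq big1// => y yV; case: asboolP => // Py.
  by move: xV; rewrite (inj x y) ?mem_head ?inE ?yV ?orbT.
rewrite add0n; apply: IH => // y z yV zV; apply: inj; rewrite inE ?yV ?zV orbT//.
Qed.

(** This replaces Euler's formula.  For a generic height each tile has at most one
    lowest and one highest point in [V].  At a point [x] of [V] where [k] tiles
    start or end there are at most [k + 2] tiles, by [middle_tiles], and at least
    3, so [k] is positive and there are at most [3 k] of them.  The sum of the
    numbers [k] over [V] is at most twice the number of tiles. *)
Lemma valence_sum (V : seq (plane R)) (Q : seq (set (plane R))) :
  uniq V -> uniq Q -> (forall A, A \in Q -> T A) ->
  (forall x, x \in V -> (3 <= \sum_(A <- Q) `[< A x >])%N) ->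
  (\sum_(x <- V) \sum_(A <- Q) `[< A x >] <= 6 * size Q)%N.
Proof.
move=> uV uQ QT val3; have [tau inj] := generic_height V.
pose lo A x : nat := `[< A x /\ lowest tau A x >].
pose hi A x : nat := `[< A x /\ highest tau A x >].
apply: (@leq_trans (\sum_(x <- V) 3 * (\sum_(A <- Q) (lo A x + hi A x)))%N).
  rewrite big_seq [leqRHS]big_seq; apply: leq_sum => x xV.
  have := middle_tiles tau x _ uQ QT; have := val3 _ xV.
  have : (\sum_(A <- Q) `[< A x >] <=
      \sum_(A <- Q) `[< [/\ A x, ~ lowest tau A x & ~ highest tau A x] >] +
      \sum_(A <- Q) (lo A x + hi A x))%N.
    rewrite -big_split; apply: leq_sum => A _; rewrite /lo /hi.
    case: asboolP => // Ax; case: asboolP => //= n.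
    case: asboolP => //= nl; case: asboolP => //= nh; case: n; split => // h.
      by apply: nl.
    by apply: nh.
  lia.
rewrite -big_distrr/= exchange_big/=.
have -> : (6 * size Q = 3 * \sum_(A <- Q) 2)%N.
  by rewrite big_const_seq count_predT iter_addn_0 mulnA.
rewrite leq_mul2l; apply: leq_sum => A _.
rewrite big_split/= (@leq_add _ _ 1 1)//; apply: sum_asbool_le1 => // x y xV yV.
  move=> [Ax lx] [Ay ly]; apply: inj => //; apply/le_anti.
  by rewrite lx// ly.
move=> [Ax lx] [Ay ly]; apply: inj => //; apply/le_anti.
by rewrite lx// ly.
Qed.
End ValenceCount.

(** * Patches *)

Section Patches.
Local Open Scope classical_set_scope.
Local Open Scope ring_scope.
Context {R : realType}.
Implicit Types (A B C : set (plane R)).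
Implicit Types (x y z c p q M : plane R) (r s t : R).

Lemma edist_continuous M : continuous (fun x => edist x M).
Proof.
move=> x; apply: (cvgrPdist_le (F := nbhs x) _ _).2 => e e0; apply/nbhs_ballP; exists (e / 2) => /=.
  by rewrite divr_gt0.
move=> y; rewrite -ball_normE /= => xy.
have xy2 := edist_le_norm x y.
rewrite ler_norml; apply/andP; split.
  by have := edist_triangle x y M; rewrite (edist_sym y x); lra.
by have := edist_triangle y x M; lra.
Qed.

Lemma disk_closed r M : closed (disk r M).
Proof.
apply: (@closed_comp _ _ (fun x => edist x M) [set s | s <= r]).
  by move=> x _; exact: edist_continuous.
exact: closed_le.
Qed.

Lemma edist_ray x M t : 0 <= t -> edist (x + t *: (x - M)) M = (1 + t) * edist x M.
Proof.
move=> t0; rewrite !edistE !mxE.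
rewrite [X in Num.sqrt X](_ : _ = (1 + t) ^+ 2 * ((x 0 0 - M 0 0) ^+ 2 + (x 0 1 - M 0 1) ^+ 2)).
  by rewrite sqrtrM ?sqr_ge0// sqrtr_sqr ger0_norm// addr_ge0.
ring.
Qed.

Lemma circle_boundary r M x : 0 < r -> edist x M = r -> boundary (disk r M) x.
Proof.
move=> r0 xr; split; first by apply: subset_closure; rewrite /disk/= xr.
move=> /interior_normP[e e0 eD].
have m0 := normr_ge0 (x - M).
pose t := e / (1 + `|x - M|); have t0 : 0 < t by rewrite divr_gt0// ltr_wpDr.
have := eD (x + t *: (x - M)); rewrite /disk/= (edist_ray _ _ _ (ltW t0)) xr.
rewrite addrAC subrr add0r normrZ gtr0_norm// /t mulrAC ltr_pdivrMr ?ltr_wpDr//.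
rewrite ltr_pM2l// ltrDr ltr01 -/t => /(_ isT); rewrite leNgt => /negP; apply.
by rewrite mulrDl mul1r ltrDl mulr_gt0.
Qed.

Variables (T : set (set (plane R))) (u U : R).
Hypothesis cT : convex_tiling T u U.

Lemma meeting_patch A r M : 0 < r -> tiles_meeting T M r A -> patch T r M A.
Proof.
move=> r0 [TA [z [Az zr]]]; left.
have [AD|nAD] := pselect (A `<=` disk r M); first by left.
right; split => //; move/existsNP: (nAD) => [y /not_implyP[Ay /negP]].
rewrite /disk/= -ltNge => yr.
have clO : closed [set x | r <= edist x M].
  apply: (@closed_comp _ _ (fun x => edist x M) [set s | r <= s]).
    by move=> x _; exact: edist_continuous.
  exact: closed_ge.
have [t|t t01 [tr1 tr2]] := segment_crossing _ _ z y (disk_closed r M) clO zr (ltW yr).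
  by move=> _; rewrite /disk/=; case: (lerP (edist (z + t *: (y - z)) M) r) => h; [left|right; exact: ltW].
exists (z + t *: (y - z)); split; first exact: (ct_convex _ _ _ cT).
by apply: circle_boundary => //; apply/le_anti; rewrite tr2 andbT.
Qed.

Lemma meeting_subset A r M x : tiles_meeting T M r A -> A x -> edist x M <= r + U.
Proof.
move=> [TA [z [Az zr]]] Ax; apply: le_trans (edist_triangle z _ _) _.
rewrite addrC lerD//; exact: ct_diam cT _ _ _ TA Ax Az.
Qed.

Lemma patch_F2_meeting A r M : patch_F2 T r M A -> tiles_meeting T M r A.
Proof.
move=> [TA [z [Az [zc _]]] _]; split => //; exists z; split => //.
by rewrite (closure_id (disk r M)).1//; exact: disk_closed.
Qed.

(** The ray that starts at [x] and points away from [M] avoids the disk of radius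
    [s], and it is connected and unbounded. *)
Lemma far_unsurrounded K s M x : (forall y, K y -> edist y M <= s) -> 0 <= s ->
  s < edist x M -> ~ bounded_set (connected_component (~` K) x).
Proof.
move=> Ks s0 sx [b [_ bP]].
have xM : x != M.
  apply: contraTneq sx => ->; rewrite -leNgt edistE !subrr !expr0n/= addr0 sqrtr0//.
have m0 : 0 < `|x - M| by rewrite normr_gt0 subr_eq0.
(* at the parameter N the ray leaves the ball of radius |b| + 1 *)
pose N := (`|b| + 2 + `|x|) / `|x - M|.
have N0 : 0 <= N by rewrite divr_ge0 ?addr_ge0.
pose g t : plane R := x + t *: (x - M).
have cg : continuous g.
  by move=> t; apply: cvgD; [exact: cvg_cst | apply: cvgZr_tmp; exact: cvg_id].
have ray : g @` `[0, N] `<=` connected_component (~` K) x.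
  apply: connected_component_max.
  - by exists 0; rewrite /= ?in_itv/= ?lexx// /g scale0r addr0.
  - move=> _ [t + <-] /Ks; rewrite /= in_itv/= => /andP[t0 _].
    rewrite leNgt edist_ray// => /negP; apply; apply: lt_le_trans sx _.
    by rewrite ler_peMl ?edist_ge0// lerDl.
  - apply: connected_continuous_connected; first exact: segment_connected.
    exact: continuous_subspaceT.
have gN : connected_component (~` K) x (g N).
  by apply: ray; exists N => //; rewrite /= in_itv/= N0 lexx.
have := bP (`|b| + 1) _ _ gN; rewrite /=.
have -> : b < `|b| + 1 by rewrite (le_lt_trans (ler_norm b))// ltrDl.
move=> /(_ isT); rewrite leNgt => /negP; apply.
have : `|N *: (x - M)| <= `|g N| + `|x|.
  by rewrite -{1}(addrK x (N *: _)) (addrC _ x) -/(g N); exact: ler_normB.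
rewrite normrZ ger0_norm// /N divfK ?gt_eqF//; lra.
Qed.

(** Tiles of the first two kinds meet the disk of radius [r], and a surrounded
    tile cannot lie entirely beyond the tiles that surround it. *)
Lemma patch_meeting A r M : 0 < r -> patch T r M A -> tiles_meeting T M (r + U) A.
Proof.
have U0 := ct_U _ _ _ cT.
move=> r0; have rU : r <= r + U by rewrite lerDl ltW.
have grow B : tiles_meeting T M r B -> tiles_meeting T M (r + U) B.
  by move=> [TB [z [Bz zr]]]; split => //; exists z; split => //; exact: le_trans zr rU.
move=> [[[TA AD]|/patch_F2_meeting/grow//]|[TA _ sur]].
  apply: grow; split => //; have [a Aa] := tile_interior _ _ _ cT _ TA.
  by exists a; split; [|apply: AD]; exact: interior_subset.
split => //; have [a Aa] := tile_interior _ _ _ cT _ TA.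
exists a; split; first exact: interior_subset.
have Ks y : (\bigcup_(B in patch_F2 T r M) B) y -> edist y M <= r + U.
  by move=> [B /patch_F2_meeting mB By]; exact: meeting_subset mB By.
have [Ka|nKa] := pselect ((\bigcup_(B in patch_F2 T r M) B) a); first exact: Ks.
rewrite /disk/= leNgt; apply/negP => far.
apply: (@far_unsurrounded _ _ _ _ Ks _ far).
  by rewrite addr_ge0// ltW.
by apply: sur => //; exact: interior_subset.
Qed.

Lemma patch_finite r M : 0 < r -> finite_set (patch T r M).
Proof.
move=> r0; apply: (@sub_finite_set _ _ (tiles_meeting T M (r + U))).
  by move=> A; exact: patch_meeting.
apply: (tiles_meeting_card _ _ _ cT _ _ _).1.
by rewrite addr_ge0 ?(ltW r0) ?(ltW (ct_U _ _ _ cT)).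
Qed.

Lemma count_ncard (X : choiceType) (S : set X) (P : X -> Prop) : finite_set S ->
  ncard [set a | S a /\ P a] = (\sum_(a <- fset_set S) `[< P a >])%N.
Proof.
move=> fS; rewrite /ncard.
have fP : finite_set [set a | S a /\ P a] by apply: sub_finite_set fS => a [].
rewrite sum_asbool.
apply/perm_size/uniq_perm; [exact: fset_uniq|exact/filter_uniq/fset_uniq|] => a.
rewrite mem_filter !in_fset_set//; apply/idP/andP.
  by move=> /set_mem[Sa Pa]; split; [exact/asboolP|exact/mem_set].
by move=> [/asboolP Pa /set_mem Sa]; exact/mem_set.
Qed.

(** The vertices found by [adjacents_vertices] on the tiles of the patch are
    surrounded by tiles that meet a slightly larger disk; [valence_sum] bounds
    the number of incidences between these vertices and tiles. *)
Lemma adjacents_sum r M n : 0 < r ->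
  (\sum_(3 <= h < n) h * num_tiles_adj T h r M <=
     6 * ncard (tiles_meeting T M (r + U + U)))%N.
Proof.
move=> r0; have U0 := ct_U _ _ _ cT.
have finP := patch_finite r M r0.
have finQ : finite_set (tiles_meeting T M (r + U + U)).
  by apply: (tiles_meeting_card _ _ _ cT _ _ _).1; rewrite !addr_ge0 ?(ltW r0) ?(ltW U0).
set P := fset_set (patch T r M); set Q := fset_set (tiles_meeting T M (r + U + U)).
have PT A : A \in P -> T A.
  by rewrite in_fset_set// inE => /(patch_meeting _ _ _ r0)[].
have QT A : A \in Q -> T A by rewrite in_fset_set// inE => -[].
have /choice[vs vsP] : forall A, exists s : seq (plane R), [/\ uniq s,
    forall x, x \in s -> A x /\ is_vertex T x &
    forall h, T A -> has_adjacents T h A -> size s = h].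
  move=> A.
  have [[h [TA hA]]|nA] := pselect (exists h, T A /\ has_adjacents T h A); last first.
    by exists [::]; split => // h TA hA; case: nA; exists h.
  have [s [us ss sv]] := adjacents_vertices _ _ _ cT _ _ TA hA.
  by exists s; split => // k _ kA; rewrite ss -(card_fset_set hA) (card_fset_set kA).
pose V := undup (flatten [seq vs A | A <- P]).
have adjvs A : A \in P ->
    (\sum_(3 <= h < n) h * `[< has_adjacents T h A >] <= size (vs A))%N.
  move=> AP; have [_ _ szA] := vsP A.
  rewrite [leqLHS](eq_bigr (fun h => (if h == size (vs A) then
      h * `[< has_adjacents T h A >] else 0)%N)); last first.
    move=> h _; case: eqP => // nh; case: asboolP => [/szA|]; last by rewrite muln0.
    by move=> /(_ (PT _ AP)) /esym.
  rewrite -big_mkcond big_nat1_eq; case: ifP => // _.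
  by case: asboolP; rewrite ?muln1 ?muln0.
rewrite (eq_bigr (fun h => \sum_(A <- P) h * `[< has_adjacents T h A >]))%N; last first.
  by move=> h _; rewrite /num_tiles_adj count_ncard// big_distrr.
rewrite exchange_big/=.
apply: (@leq_trans (\sum_(A <- P) \sum_(x <- V) `[< A x >])%N).
  rewrite big_seq [leqRHS]big_seq; apply: leq_sum => A AP.
  apply: leq_trans (adjvs _ AP) _; have [uA vA _] := vsP A.
  rewrite sum_asbool; apply: uniq_leq_size => // x xA; rewrite mem_filter mem_undup.
  apply/andP; split; first by apply/asboolP; have [] := vA _ xA.
  by apply/flattenP; exists (vs A) => //; exact: map_f.
rewrite exchange_big/=.
have VQ x A : x \in V -> T A -> A x -> A \in Q.
  rewrite mem_undup => /flattenP[_ /mapP[B BP ->] xB] TA Ax.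
  have [_ /(_ _ xB)[Bx _] _] := vsP B.
  have mB : tiles_meeting T M (r + U) B.
    by apply: patch_meeting => //; move: BP; rewrite in_fset_set// inE.
  rewrite in_fset_set// inE; split => //; exists x; split => //.
  exact: meeting_subset mB Bx.
apply: (@leq_trans (\sum_(x <- V) \sum_(A <- Q) `[< A x >])%N).
  apply: leq_sum => x _.
  rewrite !sum_asbool; apply: uniq_leq_size; first exact/filter_uniq/fset_uniq.
  move=> A; rewrite !mem_filter => /andP[-> /=].
  rewrite !in_fset_set// !inE => /(patch_meeting _ _ _ r0)[TA [z [Az zr]]].
  split => //; exists z; split => //; rewrite /disk/= in zr *.
  by apply: le_trans zr _; rewrite lerDl ltW.
apply: (@valence_sum R T u U cT V Q); rewrite ?undup_uniq ?fset_uniq//.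
move=> x xV.
have [_ vx] : True /\ is_vertex T x.
  split => //; move: xV; rewrite mem_undup => /flattenP[_ /mapP[B BP ->] xB].
  by have [_ /(_ _ xB)[_ vx] _] := vsP B.
have sub : tiles_at T x `<=` [set` Q] by move=> A [TA Ax]; exact: (VQ x).
have finx : finite_set (tiles_at T x) by exact: finite_subfset sub.
apply: leq_trans (leq_card_fset_set finx vx) _.
rewrite sum_asbool; apply: uniq_leq_size => // A; rewrite in_fset_set// inE => -[TA Ax].
by rewrite mem_filter (VQ x)// andbT; apply/asboolP.
Qed.
End Patches.

(** * Passing to the limit *)

Section Density.
Local Open Scope classical_set_scope.
Local Open Scope ring_scope.
Context {R : realType}.
Implicit Types (r s t : R).

Lemma bernoulli_inequality s n : 0 <= s -> 1 + n%:R * s <= (1 + s) ^+ n.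
Proof.
move=> s0; elim: n => [|n IH]; first by rewrite mul0r addr0 expr0.
rewrite exprS; apply: le_trans (_ : (1 + s) * (1 + n%:R * s) <= _); last first.
  by rewrite ler_wpM2l// addr_ge0.
have : 0 <= n%:R * s ^+ 2 by rewrite mulr_ge0// sqr_ge0.
rewrite -natr1; nra.
Qed.

(** The cube of Bernoulli's inequality, [(1 + m s) ^ 3 <= (1 + s) ^ (3 m)], is
    already too large. *)
Lemma exponential_beats_square s a b : 0 < s -> 0 <= a -> 0 <= b ->
  ~ forall n : nat, (1 + s) ^+ n <= (a * n%:R + b) ^+ 2.
Proof.
move=> s0 a0 b0 bound.
(* 3 a m + b <= C (1 + m s) for all m *)
pose C := 3 * a / s + b; have C0 : 0 <= C.
  by rewrite addr_ge0// divr_ge0 ?mulr_ge0// ltW.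
suff bounded (m : nat) : 1 + m%:R * s <= C ^+ 2.
  have := bounded (Num.truncn (C ^+ 2 / s)).+1.
  have /truncn_itv/andP[_] : 0 <= C ^+ 2 / s by rewrite divr_ge0 ?sqr_ge0// ltW.
  by rewrite ltr_pdivrMr//; lra.
have p0 : 0 < 1 + m%:R * s by rewrite ltr_wpDr// mulr_ge0// ltW.
rewrite -(ler_pM2r (exprn_gt0 2 p0)) -exprS -exprMn.
apply: le_trans (_ : (1 + s) ^+ (m * 3) <= _).
  rewrite exprM; apply: lerXn2r; rewrite ?nnegrE ?(ltW p0) ?exprn_ge0 ?addr_ge0 ?(ltW s0)//.
  by apply: bernoulli_inequality; exact: ltW.
apply: le_trans (bound _) _; rewrite natrM.
have m0 : 0 <= m%:R :> R by [].
apply: lerXn2r; rewrite ?nnegrE.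
- by rewrite addr_ge0// !mulr_ge0.
- by apply: mulr_ge0 => //; exact: ltW.
have -> : C * (1 + m%:R * s) = 3 * a / s + b + 3 * a * m%:R + b * (m%:R * s).
  by rewrite /C; field; rewrite gt_eqF.
have : 0 <= 3 * a / s by rewrite divr_ge0 ?mulr_ge0// ltW.
have : 0 <= b * (m%:R * s) by rewrite !mulr_ge0// ltW.
lra.
Qed.

(** Otherwise [N] would grow by the factor [1 + s] at each step of length [w],
    hence exponentially. *)
Lemma slow_growth (N : R -> nat) a b w : 0 <= a -> 0 <= b -> 0 < w ->
  (forall r, 0 <= r -> (0 < N r)%N) ->
  (forall r, 0 <= r -> (N r)%:R <= (a * r + b) ^+ 2 :> R) ->
  forall s r0, 0 < s -> exists2 r, r0 <= r & (N (r + w))%:R < (1 + s) * (N r)%:R :> R.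
Proof.
move=> a0 b0 w0 Npos Nle s r0 s0; apply: contrapT => none.
pose r1 := Num.max r0 0; have r10 : 0 <= r1 by rewrite le_max lexx orbT.
have step r : r1 <= r -> (1 + s) * (N r)%:R <= (N (r + w))%:R :> R.
  rewrite ge_max => /andP[r0r _]; rewrite leNgt; apply/negP => h.
  by apply: none; exists r.
have rk k : r1 <= r1 + k%:R * w by rewrite lerDl mulr_ge0// ltW.
have grow k : (1 + s) ^+ k <= (N (r1 + k%:R * w))%:R :> R.
  elim: k => [|k IH]; first by rewrite mul0r addr0 expr0 ler1n Npos.
  rewrite -natr1 mulrDl mul1r addrA exprS; apply: le_trans (step _ (rk k)).
  by rewrite ler_wpM2l// addr_ge0// ltW.
apply: (@exponential_beats_square s (a * w) (a * r1 + b) s0).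
- by rewrite mulr_ge0// ltW.
- by rewrite addr_ge0// mulr_ge0.
move=> k; apply: le_trans (grow k) _.
apply: le_trans (Nle _ (le_trans r10 (rk k))) _.
by rewrite le_eqVlt; apply/orP; left; apply/eqP; congr (_ ^+ 2); ring.
Qed.

Variables (T : set (set (plane R))) (M : plane R).

Lemma tile_density_ge0 h : cvg (tile_ratio T M h @ +oo) -> 0 <= tile_density T M h.
Proof.
move=> cv; apply: limr_ge => //.
by apply: nearW => r; rewrite /tile_ratio divr_ge0.
Qed.

Lemma partial_density_cvg n : (forall h, cvg (tile_ratio T M h @ +oo)) ->
  (fun r => \sum_(3 <= h < n) h%:R * tile_ratio T M h r) @ +oo -->
  \sum_(3 <= h < n) h%:R * tile_density T M h.
Proof.
move=> cv; elim: (index_iota 3 n) => [|h hs IH].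
  rewrite big_nil (_ : (fun _ => _) = cst 0); first exact: cvg_cst.
  by apply/funext => r; rewrite big_nil.
rewrite big_cons (_ : (fun _ => _) = (fun r => h%:R * tile_ratio T M h r +
  \sum_(j <- hs) j%:R * tile_ratio T M j r)).
  by apply: cvgD => //; apply: cvgMl_tmp; exact: cv.
by apply/funext => r; rewrite big_cons.
Qed.

(** If the sum exceeded 6, it would exceed [6 (1 + s)] for all large patches.  By
    [slow_growth] there is a large [r] for which the disks of radii [r] and
    [r + 2 U] meet almost the same number of tiles, within the factor [1 + s];
    this contradicts [adjacents_sum]. *)
Lemma partial_density_le6 u U n : convex_tiling T u U ->
  (forall h, cvg (tile_ratio T M h @ +oo)) ->
  \sum_(3 <= h < n) h%:R * tile_density T M h <= 6.
Proof.
move=> cT cv; rewrite leNgt; apply/negP => S6.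
set S := \sum_(_ <= _ < _) _ in S6.
pose s := (S - 6) / 12; have s0 : 0 < s by rewrite divr_gt0// subr_gt0.
have sS : 6 * (1 + s) < S by rewrite /s; lra.
have [r0 [_ r0P]] := cvgr_gt _ (partial_density_cvg n cv) _ sS.
have [u0 U0] := (ct_u _ _ _ cT, ct_U _ _ _ cT).
pose N r := ncard (tiles_meeting T M r).
have Npos r : 0 <= r -> (0 < N r)%N.
  move=> rpos; have [_ cov _] := ct_tiling _ _ _ cT.
  have : setT M by [].
  rewrite -cov => -[A TA AM].
  have [fin _] := tiles_meeting_card _ _ _ cT M r rpos.
  rewrite /N /ncard cardfs_gt0; apply/fset0Pn; exists A.
  rewrite in_fset_set// inE; split => //; exists M; split => //.
  by rewrite /disk/= edistE !subrr !expr0n/= addr0 sqrtr0.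
have ui : 0 <= u^-1 by rewrite invr_ge0 ltW.
have [r r1 grow] : exists2 r, Num.max r0 0 + 1 <= r &
    (N (r + (U + U)))%:R < (1 + s) * (N r)%:R :> R.
  apply: (@slow_growth N (2 / u) (2 * U / u + 1)) => //.
  - by rewrite mulr_ge0.
  - by rewrite addr_ge0// !mulr_ge0// ltW.
  - by rewrite addr_gt0.
  - by move=> r rpos; have [] := tiles_meeting_card _ _ _ cT M r rpos.
have m1 : r0 <= Num.max r0 0 by rewrite le_max lexx.
have m2 : 0 <= Num.max r0 0 by rewrite le_max lexx orbT.
have rpos : 0 < r by lra.
have r0r : r0 < r by lra.
have Nt : (N r <= num_tiles T r M)%N.
  have [fin _] := tiles_meeting_card _ _ _ cT M r (ltW rpos).
  rewrite /N /num_tiles /ncard; apply/fsubset_leq_card.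
  rewrite -fset_set_sub//; last exact: patch_finite cT _ _ rpos.
  by move=> A; exact: meeting_patch cT _ _ _ rpos.
have tpos : 0 < (num_tiles T r M)%:R :> R.
  by rewrite ltr0n (leq_trans (Npos _ (ltW rpos))).
have := r0P r r0r; rewrite /=.
rewrite (_ : \sum_(_ <= _ < _) _ =
    (\sum_(3 <= h < n) h * num_tiles_adj T h r M)%N%:R / (num_tiles T r M)%:R); last first.
  rewrite natr_sum mulr_suml; apply: eq_bigr => h _.
  by rewrite /tile_ratio mulrA natrM.
rewrite ltr_pdivlMr// ltNge => /negP; apply.
have := adjacents_sum _ _ _ cT r M n rpos.
rewrite -(ler_nat R) natrM -addrA -/(N _) => /le_trans; apply.
have Nt' : (N r)%:R <= (num_tiles T r M)%:R :> R by rewrite ler_nat.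
have := ltW grow.
have : (1 + s) * (N r)%:R <= (1 + s) * (num_tiles T r M)%:R.
  by rewrite ler_wpM2l// addr_ge0// ltW.
lra.
Qed.
End Density.

Theorem proposition1 (R : realType) (n : nat) (T : set (set (plane R)))
    (M : plane R) (hn : (3 <= n)%N)
    (hgon : forall A : set (plane R), T A -> convex_ngon n A)
    (hbal : strongly_balanced T M) :
  (\sum_(3 <= h <oo) (h%:R * tile_density T M h)%:E <= 6%:E)%E.
Proof.
have [nT cvt _] := hbal.
have [u [U cT]] := normal_convex_tiling _ _ nT hgon.
apply: lime_le.
  apply: is_cvg_nneseries => h _ _; rewrite lee_fin.
  by rewrite mulr_ge0// tile_density_ge0.
apply: nearW => m; rewrite sumEFin lee_fin.
exact: partial_density_le6 cT cvt.
Qed.
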